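(* Let $\Delta(t) \in \mathbf{Z}[t]$ be a nonzero polynomial that has a nonconstant factor, irreducible in $\mathbf{Q}[t]$, which is neither a constant multiple of a cyclotomic polynomial nor a monomial. Then the set of natural numbers $n$ for which $\Delta(t)$ is $n$-Hartley is finite.
   Context: For a positive integer $n$, let $\zeta_n = \exp(2\pi i/n)$. A polynomial $\Delta(t) \in \mathbf{Z}[t]$ is called $n$-Hartley if there exists $g(t) \in \mathbf{Z}[t]$ such that $\Delta(t^n) = \pm \prod_{i=0}^{n-1} g(\zeta_n^i t)$ (for some choice of sign). *)

(* Defs.v *)
From HB Require Import structures.
From mathcomp Require Import all_boot all_order all_algebra all_field.
From mathcomp Require Import complex.
From mathcomp Require Import classical_sets cardinality reals trigo.

Set Implicit Arguments.
Unset Strict Implicit.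
Unset Printing Implicit Defensive.

Import GRing.Theory.
Local Open Scope ring_scope.

Definition zeta (R : realType) (n : nat) : R[i] :=
  Complex (cos (2 * pi / n%:R)) (sin (2 * pi / n%:R)).

(* Only meaningful for [0 < n].  The equality is one of polynomials over R[i];
   [p \Po (c *: 'X)] is p(c t). *)
Definition hartley (R : realType) (n : nat) (Delta : {poly int}) : Prop :=
  exists g : {poly int},
    let P : {poly R[i]} :=
      \prod_(i < n) (map_poly intr g \Po (zeta R n ^+ i *: 'X)) in
    map_poly intr (Delta \Po 'X^n) = P \/ map_poly intr (Delta \Po 'X^n) = - P.

(* Main.v *)
(** Comparing roots in [Delta(t^n) = ± \prod_i g(zeta^i t)], the [n]-th powers
    of the roots of [g] are exactly the roots of [Delta], while [deg g = deg Delta]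
    and [|lead g|^n = |lead Delta|].  Hence the roots, the leading coefficient
    and so the coefficients of [g] are bounded independently of [n], and only
    finitely many integer polynomials [g] can occur.  For a fixed [g] and a root
    [l] of [Delta] that is neither zero nor a root of unity, every [n] gives a
    root [b] of [g] with [b^n = l]; a given [b] serves at most one [n], since
    [b^n = b^m = l] with [n <> m] forces [b], hence [l], to be zero or a root of
    unity. *)
Require Import Defs.
From HB Require Import structures.
From mathcomp Require Import all_boot all_order all_algebra all_field.
From mathcomp Require Import complex.
From mathcomp Require Import classical_sets cardinality reals trigo.
From mathcomp Require Import lra.

Import Order.TTheory GRing.Theory Num.Theory.

Local Open Scope classical_set_scope.
Local Open Scope ring_scope.

(** * Roots of unity in [R[i]] and bounds on coefficients *)

Lemma zetaX (R : realType) (n k : nat) :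
  zeta R n ^+ k =
  Complex (cos (k%:R * (2 * pi / n%:R))) (sin (k%:R * (2 * pi / n%:R))).
Proof.
elim: k => [|k IHk]; first by rewrite expr0 mul0r cos0 sin0.
rewrite exprSr IHk /zeta -[k.+1%:R]natr1 (mulrDl k%:R) mul1r cosD sinD.
by apply/eqP; rewrite eq_complex /= [X in _ && (X == _)]addrC !eqxx.
Qed.

Lemma zeta_unity (R : realType) (n : nat) : (0 < n)%N -> zeta R n ^+ n = 1.
Proof.
move=> n_gt0; rewrite zetaX mulrCA divff ?pnatr_eq0 -?lt0n // mulr1.
by rewrite mulr_natl cos2pi sin2pi.
Qed.

(** In the partial order of [R[i]], [0 <= x] forces the imaginary part to vanish, so the Archimedean
    property of [R] applies. *)
Lemma complex_le_nat (R : realType) (x : R[i]) :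
  0 <= x -> exists N : nat, x <= N%:R.
Proof.
case: x => a b; rewrite lecE /= => /andP[/eqP -> a_ge0].
exists (Num.bound a).
rewrite -(rmorph_nat (real_complex R)) lecE /= eqxx.
exact/ltW/archi_boundP.
Qed.

(** A factor X - z turns the coefficients c_k into c_(k-1) - z c_k, so it costs at most a factor 1 +
    B, uniformly in k. *)
Lemma normr_coef_prod_XsubC (C : numDomainType) (s : seq C) (B : C) (k : nat) :
  0 <= B -> {in s, forall z, `|z| <= B} ->
  `|(\prod_(z <- s) ('X - z%:P))`_k| <= (1 + B) ^+ size s.
Proof.
move=> B_ge0; elim: s k => [|z s IHs] k sB.
  rewrite big_nil coef1 expr0; case: (k == _); rewrite /= ?normr1 ?normr0 //.
have {}IHs j : `|(\prod_(z <- s) ('X - z%:P))`_j| <= (1 + B) ^+ size s.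
  by apply: IHs => y ys; apply: sB; rewrite inE ys orbT.
rewrite big_cons mulrBl coefB coefXM coefCM /= exprS [in leRHS]mulrDl mul1r.
apply: (le_trans (ler_normB _ _)); apply: lerD.
  by case: (k == 0%N) => //; rewrite normr0 exprn_ge0 // addr_ge0.
by rewrite normrM ler_pM // sB // mem_head.
Qed.

Lemma finite_bounded_intpoly (d N : nat) :
  finite_set [set g : {poly int} | (size g <= d)%N /\ forall k, `|g`_k| <= N%:Z].
Proof.
(* Shifted by N, the coefficients lie between 0 and 2N, so finitely many functions encode all these
   polynomials. *)
pose F (f : {ffun 'I_d -> 'I_(N + N).+1}) : {poly int} :=
  \poly_(i < d) (if insub i is Some j then (f j)%:Z - N%:Z else 0).
apply: (@sub_finite_set _ _ [set F f | f in [set: {ffun 'I_d -> 'I_(N + N).+1}]]).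
  move=> g /= [szg gN]; exists [ffun i : 'I_d => inord `|(g`_i + N%:Z)%R|%N] => //.
  apply/polyP => i; rewrite coef_poly; case: ltnP => [lt_id|le_di]; last first.
    by rewrite nth_default // (leq_trans szg).
  rewrite insubT ffunE /=.
  have := gN i; rewrite ler_norml => /andP[g1 g2].
  have g3 : 0 <= g`_i + N%:Z by lra.
  rewrite inordK; first by rewrite gez0_abs // addrK.
  by rewrite ltnS -lez_nat gez0_abs // PoszD lerD2r.
exact/finite_image/finite_finset.
Qed.

(** * Roots, degree and leading coefficient under the product identity *)

Section TwistedProduct.
Context (C : numClosedFieldType) (z : C) (n : nat) (n_gt0 : (0 < n)%N).
Hypothesis zn1 : z ^+ n = 1.
Implicit Types (D g : {poly C}) (b l : C).

Definition twisted_prod g := \prod_(i < n) (g \Po (z ^+ i *: 'X)).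

Lemma horner_twisted_prod g b :
  (twisted_prod g).[b] = \prod_(i < n) g.[z ^+ i * b].
Proof.
by rewrite horner_prod; apply: eq_bigr => i _; rewrite horner_comp !hornerE.
Qed.

Lemma twisted_prod_rootX D g b :
  D \Po 'X^n = twisted_prod g \/ D \Po 'X^n = - twisted_prod g ->
  root g b -> root D (b ^+ n).
Proof.
move=> DE /rootP gb0; have P0 : (twisted_prod g).[b] = 0.
  (* The factor of index 0 is g itself. *)
  by rewrite horner_twisted_prod (bigD1 (Ordinal n_gt0)) //= expr0 mul1r gb0 mul0r.
apply/rootP; rewrite -[b ^+ n]hornerXn -horner_comp.
by case: DE => ->; rewrite ?hornerN P0 ?oppr0.
Qed.

(** For an n-th root t of l, some factor g(z^i X) vanishes at t; then z^i t is a root of g, and its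
    n-th power is still l. *)
Lemma twisted_prod_root_ex D g l :
  D \Po 'X^n = twisted_prod g \/ D \Po 'X^n = - twisted_prod g ->
  root D l -> exists2 b, root g b & b ^+ n = l.
Proof.
move=> DE /rootP Dl0; pose t := n.-root l.
have tn : t ^+ n = l by exact: rootCK.
have /eqP : (twisted_prod g).[t] = 0.
  have : (D \Po 'X^n).[t] = 0 by rewrite horner_comp hornerXn tn.
  by case: DE => -> //; rewrite hornerN => /eqP; rewrite oppr_eq0 => /eqP.
rewrite horner_twisted_prod => /prodf_eq0[i _ gi].
by exists (z ^+ i * t); rewrite // exprMn -exprM mulnC exprM zn1 expr1n mul1r.
Qed.

Let normz : `|z| = 1.
Proof.
by apply/eqP; rewrite -(@pexpr_eq1 _ _ n) // -normrX zn1 normr1.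
Qed.

Let zX_neq0 i : z ^+ i != 0.
Proof. by rewrite -normr_gt0 normrX normz expr1n. Qed.

Let size_zX i : size (z ^+ i *: 'X : {poly C}) = 2.
Proof. by rewrite size_scale ?size_polyX. Qed.

(** Since |z| = 1, each factor has the degree of g and a leading coefficient of the same modulus; n
    factors face D(X^n), of degree n deg D. *)
Lemma size_lead_twisted_prod D g : D != 0 ->
  D \Po 'X^n = twisted_prod g \/ D \Po 'X^n = - twisted_prod g ->
  size g = size D /\ `|lead_coef g| ^+ n = `|lead_coef D|.
Proof.
move=> D0 DE.
have szE : size (D \Po 'X^n) = size (twisted_prod g).
  by case: DE => ->; rewrite ?size_polyN.
have leadE : `|lead_coef (D \Po 'X^n)| = `|lead_coef (twisted_prod g)|.
  by case: DE => ->; rewrite ?lead_coefN ?normrN.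
have lead_g i : `|lead_coef (g \Po (z ^+ i *: 'X))| = `|lead_coef g|.
  rewrite lead_coef_comp ?size_zX // lead_coefZ lead_coefX mulr1.
  by rewrite normrM !normrX normz !expr1n mulr1.
have normE : `|lead_coef g| ^+ n = `|lead_coef D|.
  move: leadE; rewrite lead_coef_comp ?size_polyXn // lead_coefXn expr1n mulr1.
  rewrite lead_coef_prod normr_prod (eq_bigr (fun=> `|lead_coef g|)) => [|i _].
    by rewrite prodr_const card_ord => ->.
  exact: lead_g.
have g0 : g != 0.
  apply: contra_neq D0 => g0; apply/eqP; rewrite -lead_coef_eq0 -normr_eq0 -normE.
  by rewrite g0 lead_coef0 normr0 expr0n -leqn0 leqNgt n_gt0.
have szfac i : size (g \Po (z ^+ i *: 'X)) = size g by rewrite size_comp_poly2.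
split=> //; move: szE; rewrite size_prod => [|i _]; last first.
  by rewrite -size_poly_gt0 szfac size_poly_gt0.
rewrite (eq_bigr (fun=> size g)) // sum_nat_const card_ord.
(* [size] is the degree plus one, so predecessors are taken to compare n deg D with n deg g. *)
move=> /(congr1 predn); rewrite size_comp_poly size_polyXn /=.
have [] : (0 < size g)%N /\ (0 < size D)%N by rewrite !size_poly_gt0.
case: (size g) (size D) => [|dg] [|dD] // _ _ /=.
rewrite mulnS -addnS addKn /= mulnC => /eqP.
by rewrite eqn_pmul2l // => /eqP ->.
Qed.

End TwistedProduct.

(** * Irreducible polynomials vanishing at zero or at a root of unity *)

Lemma irreducible_eqp_scale (F : fieldType) (p q : {poly F}) :
  irreducible_poly p -> q %| p -> size q != 1 -> exists c, p = c *: q.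
Proof.
move=> p_irr qp q1; have := apply_irredp p_irr q1 qp.
by rewrite eqp_sym => /eqpf_eq[c _ ->]; exists c.
Qed.

(** Up to a constant, p is the minimal polynomial of any of its algebraic roots x. Here x is 0 or a
    root of unity of some exact order m, with minimal polynomial X or the m-th cyclotomic
    polynomial. *)
Lemma irreducible_root_unity (p : {poly rat}) (k n : nat) :
  irreducible_poly p -> (0 < n)%N -> p %| 'X^k * ('X^n - 1) ->
  (exists c, p = c *: 'X) \/
  (exists m c, (0 < m)%N /\ p = c *: map_poly intr 'Phi_m).
Proof.
move=> p_irr n_gt0 pdvd.
have [x px] : exists x : algC, root (map_poly ratr p) x.
  by apply/closed_rootP; rewrite size_map_poly; case: p_irr => /gtn_eqF ->.
have [q [qE q_mon] qP] := minCpolyP x.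
have qp : q %| p by rewrite -qP.
have q1 : size q != 1.
  by rewrite -(size_map_poly (ratr : {rmorphism rat -> algC})) -qE gtn_eqF ?size_minCpoly.
have [c pE] := irreducible_eqp_scale _ _ _ p_irr qp q1.
have : root (map_poly ratr ('X^k * ('X^n - 1))) x.
  by rewrite qP (dvdp_trans qp).
rewrite rmorphM rmorphB rmorph1 /= !map_polyXn rootM => /orP[].
  rewrite /root hornerXn expf_eq0 => /andP[_ /eqP x0]; left.
  apply: irreducible_eqp_scale p_irr _ _; last by rewrite size_polyX.
  rewrite -['X]subr0 -polyC0 dvdp_XsubCl -(fmorph_root (ratr : {rmorphism rat -> algC})).
  by rewrite rmorph0 -x0.
rewrite /root !hornerE subr_eq0 => /eqP xn1; right.
have [m m_prim mn] := prim_order_exists n_gt0 xn1.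
exists m, c; split; first exact: prim_order_gt0 m_prim.
rewrite pE; congr (_ *: _); apply: (map_poly_inj (ratr : {rmorphism rat -> algC})).
rewrite -qE (minCpoly_cyclotomic m_prim) -(Cintr_Cyclotomic m_prim) -map_poly_comp.
by apply: eq_map_poly => a; rewrite /= ratr_int.
Qed.

(** Otherwise p and q would be coprime over F, hence also over L, and could not share a root. *)
Lemma irreducible_root_common (F : fieldType) (L : idomainType)
  (f : {rmorphism F -> L}) (p q : {poly F}) (x : L) :
  irreducible_poly p -> root (map_poly f p) x -> root (map_poly f q) x -> p %| q.
Proof.
move=> p_irr px /rootP qx.
have /negP ncop : ~~ coprimep p q.
  by apply/negP; rewrite -(coprimep_map f) => /coprimep_root/(_ px); rewrite qx eqxx.
apply: contra_notT ncop => npq; case: p_irr => p1 p_irr.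
have [//|g1] := boolP (coprimep p q).
by case/negP: npq; rewrite -(eqp_dvdl _ (p_irr _ g1 (dvdp_gcdl _ _))) dvdp_gcdr.
Qed.

(** * Exponents n for which l is the n-th power of a root of g *)

Lemma expr_inj_nonunity (L : idomainType) (b : L) (i j : nat) :
  b != 0 -> (forall k, (0 < k)%N -> b ^+ k != 1) -> b ^+ i = b ^+ j -> i = j.
Proof.
move=> b0 bU; wlog ij : i j / (i <= j)%N => [H|].
  by case: (leqP i j) => [|/ltnW] ij e; [|symmetry]; apply: H.
rewrite -(subnKC ij) exprD => /eqP; rewrite -[eqbLHS]mulr1.
rewrite (inj_eq (mulfI (expf_neq0 _ b0))) eq_sym => /eqP e.
case: (posnP (j - i)) => [->|/bU]; first by rewrite addn0.
by rewrite e eqxx.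
Qed.

Lemma finite_exponents_roots (C : closedFieldType) (g : {poly C}) (l : C) :
  g != 0 -> l != 0 -> (forall k, (0 < k)%N -> l ^+ k != 1) ->
  finite_set [set n : nat | (0 < n)%N /\ exists2 b, root g b & b ^+ n = l].
Proof.
move=> g0 l0 lU; have [r gE] := closed_field_poly_normal g.
pose E b := [set n : nat | (0 < n)%N /\ b ^+ n = l].
apply: (@sub_finite_set _ _ (\bigcup_(b in [set` r]) E b)).
  move=> n [n_gt0 [b gb bn]]; exists b => //=.
  by move: gb; rewrite gE rootZ ?lead_coef_eq0 // root_prod_XsubC.
apply: bigcup_finite => [|b _]; first exact: finite_seq.
have [->|/set0P[m [m_gt0 bm]]] := eqVneq (E b) set0; first exact: finite_set0.
(* [E b] is contained in the singleton of m: were b zero or a root of unity, l = b^m would be one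
   too. *)
apply: sub_finite_set (finite_set1 m) => n [n_gt0 bn] /=.
apply: (@expr_inj_nonunity _ b); last by rewrite bn bm.
- by apply: contra_neq l0 => b0; rewrite -bm b0 expr0n gtn_eqF.
- move=> k k_gt0; apply: contra_neq (lU k k_gt0) => bk.
  by rewrite -bm exprAC bk expr1n.
Qed.

(** * Bounds independent of n, and the conclusion *)

Lemma hartley_twisted (R : realType) (n : nat) (D : {poly int}) :
  hartley R n D -> exists g : {poly int},
    map_poly intr D \Po 'X^n = twisted_prod R[i] (zeta R n) n (map_poly intr g) \/
    map_poly intr D \Po 'X^n = - twisted_prod R[i] (zeta R n) n (map_poly intr g).
Proof. by case=> g /=; rewrite map_comp_poly map_polyXn; exists g. Qed.

Lemma closed_roots_bounded (C : numClosedFieldType) (D : {poly C}) :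
  D != 0 -> exists2 B : C, 1 <= B & forall l, root D l -> `|l| <= B.
Proof.
move=> D0; have [r DE] := closed_field_poly_normal D.
(* The summand 1 secures [1 <= B], which later covers the roots of g in the unit disc. *)
exists (1 + \sum_(z <- r) `|z|); first by rewrite lerDl sumr_ge0.
move=> l; rewrite DE rootZ ?lead_coef_eq0 // root_prod_XsubC => lr.
rewrite (big_rem l) //= addrCA lerDl addr_ge0 ?ler01 // sumr_ge0 //.
Qed.

Lemma coef_roots_bounded (C : numClosedFieldType) (g : {poly C}) (B : C) (k : nat) :
  0 <= B -> (forall b, root g b -> `|b| <= B) ->
  `|g`_k| <= `|lead_coef g| * (1 + B) ^+ (size g).-1.
Proof.
move=> B_ge0 gB; have [->|g0] := eqVneq g 0; first by rewrite coef0 lead_coef0 normr0 mul0r.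
have [r gE] := closed_field_poly_normal g.
have szr : (size g).-1 = size r.
  by rewrite [in LHS]gE size_scale ?lead_coef_eq0 // size_prod_XsubC.
rewrite szr {1}gE coefZ normrM ler_wpM2l // normr_coef_prod_XsubC // => z zr.
by apply: gB; rewrite gE rootZ ?lead_coef_eq0 // root_prod_XsubC.
Qed.

Theorem theorem1p6 (R : realType) (Delta : {poly int}) (hDelta : Delta != 0)
  (hfactor : exists p : {poly rat},
    [/\ irreducible_poly p,
        p %| map_poly intr Delta,
        forall (m : nat) (c : rat), (0 < m)%N -> p <> c *: map_poly intr ('Phi_m)
      & forall (k : nat) (c : rat), p <> c *: 'X^k]) :
  finite_set [set n : nat | (0 < n)%N /\ hartley R n Delta].
Proof.
have [p [p_irr pD pPhi pX]] := hfactor.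
pose toC : {poly int} -> {poly R[i]} := map_poly intr.
have sztoC g : size (toC g) = size g by apply: size_map_inj_poly => //; exact: intr_inj.
have D0 : toC Delta != 0 by rewrite -size_poly_gt0 sztoC size_poly_gt0.
have [l pl] : exists l : R[i], root (map_poly ratr p) l.
  by apply/closed_rootP; rewrite size_map_poly; case: p_irr => /gtn_eqF ->.
(* This treats both exclusions at once: k = n = 1 yields l != 0, and k = 0 yields that l is not a
   root of unity. *)
have lnonunity k n : (0 < n)%N -> ~~ root ('X^k * ('X^n - 1)) l.
  move=> n_gt0; apply/negP => kn.
  have : p %| 'X^k * ('X^n - 1).
    apply: irreducible_root_common p_irr pl _.
    by rewrite rmorphM rmorphB rmorph1 /= !map_polyXn.
  case/(irreducible_root_unity _ _ _ p_irr n_gt0) => [[c /(pX 1%N)]//|[m [c [m_gt0]]]].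
  exact: pPhi.
have l0 : l != 0.
  apply: contra (lnonunity 1%N 1%N isT) => /eqP ->.
  by rewrite /root !hornerE.
have lU k : (0 < k)%N -> l ^+ k != 1.
  move=> k_gt0; apply: contra (lnonunity 0%N k k_gt0) => /eqP lk.
  by rewrite /root !hornerE lk subrr.
have Dl : root (toC Delta) l.
  have : root (map_poly ratr (map_poly intr Delta)) l.
    by apply: root_dvdp pl; rewrite dvdp_map.
  rewrite -map_poly_comp; congr (root _ _).
  by apply: eq_map_poly => a; rewrite /= ratr_int.
have [B B1 DB] := closed_roots_bounded _ _ D0.
have B0 : 0 <= B := le_trans ler01 B1.
have [N NE] : exists N : nat,
    `|lead_coef (toC Delta)| * (1 + B) ^+ (size Delta).-1 <= N%:R.
  by apply: complex_le_nat; rewrite mulr_ge0 // exprn_ge0 // addr_ge0.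
(* [S] holds every candidate g, whatever n is; [E g] collects the exponents that g can serve. *)
pose S := [set g : {poly int} | (size g <= size Delta)%N /\ forall k, `|g`_k| <= N%:Z].
pose E g := [set n : nat | (0 < n)%N /\ exists2 b, root (toC g) b & b ^+ n = l].
apply: (@sub_finite_set _ _ (\bigcup_(g in S `&` [set g | toC g != 0]) E g)); last first.
  apply: bigcup_finite => [|g [_ g0]]; last exact: finite_exponents_roots.
  by apply: sub_finite_set (finite_bounded_intpoly (size Delta) N) => g [].
move=> n [n_gt0 /hartley_twisted[g DE]].
have zn := zeta_unity R n n_gt0.
have [szg leadg] := size_lead_twisted_prod _ _ _ n_gt0 zn _ _ D0 DE.
have g0 : toC g != 0 by rewrite -size_poly_gt0 szg size_poly_gt0; exact: D0.
(* As b^n is a root of Delta, |b|^n <= B. If |b| <= 1, use [1 <= B]; otherwise |b| <= |b|^n. *)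
have gB b : root (toC g) b -> `|b| <= B.
  move=> /(twisted_prod_rootX _ _ _ n_gt0 _ _ _ DE)/DB; rewrite normrX.
  have [b1 _|b1] := real_leP (normr_real b) (real1 _); first exact: le_trans b1 B1.
  by apply: le_trans; rewrite ler_eXnr // ltW.
(* The leading coefficient of g is a nonzero integer, so its modulus is at least 1 and at most its
   own n-th power. *)
have lead_le : `|lead_coef (toC g)| <= `|lead_coef (toC Delta)|.
  rewrite -leadg ler_eXnr // /toC lead_coef_map_inj //; last exact: intr_inj.
  rewrite -intr_norm ler1z -gtz0_ge1 normr_gt0 lead_coef_eq0.
  by apply: contra_neq g0 => ->; rewrite /toC rmorph0.
exists g; last by split=> //; exact: (twisted_prod_root_ex _ _ _ n_gt0 zn _ _ _ DE Dl).
have szgD : size g = size Delta by rewrite -sztoC szg -sztoC.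
split=> //; split=> [|k]; first by rewrite szgD.
rewrite -(ler_int R[i]) intr_norm -coef_map /=.
apply: le_trans (coef_roots_bounded _ _ _ k B0 gB) _.
rewrite sztoC szgD; apply: le_trans NE.
by rewrite ler_wpM2r // exprn_ge0 // addr_ge0.
Qed.
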